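(* Let $\mu\in\mathcal P$. (i) For the gradient $\nabla_\mu\hat{\mathcal J}_r(\mu)$ of the NCD-corrected RB reduced functional, computed with sensitivities, one has $$\|\nabla_\mu\hat{\mathcal J}_h(\mu)-\nabla_\mu\hat{\mathcal J}_r(\mu)\|_2\le\Delta_{\nabla\hat{\mathcal J}_r}(\mu)=\|\underline{\Delta_{\nabla\hat{\mathcal J}_r}(\mu)}\|_2,$$ where for $1\le i\le P$ $$(\underline{\Delta_{\nabla\hat{\mathcal J}_r}(\mu)})_i:=\gamma_{d_{\mu_i}k_\mu}\Delta_{\mathrm{pr}}(\mu)^2+\gamma_{a_\mu}\,\Delta_{d_{\mu_i}\mathrm{pr}}(\mu)\,\Delta_{\mathrm{du}}(\mu)+\|r_\mu^{\mathrm{du},d_{\mu_i}}(u_{r,\mu},p_{r,\mu},d_{\mu_i}u_{r,\mu},d_{\mu_i}p_{r,\mu})\|\,\Delta_{\mathrm{pr}}(\mu).$$ (ii) For the approximate gradient $\widetilde\nabla_\mu\hat{\mathcal J}_r(\mu)$ one has $$\|\nabla_\mu\hat{\mathcal J}_h(\mu)-\widetilde\nabla_\mu\hat{\mathcal J}_r(\mu)\|_2\le\Delta_{\widetilde\nabla\hat{\mathcal J}_r}(\mu)=\|\underline{\Delta_{\widetilde\nabla\hat{\mathcal J}_r}(\mu)}\|_2,$$ where for $1\le i\le P$ $$(\underline{\Delta_{\widetilde\nabla\hat{\mathcal J}_r}(\mu)})_i:=\gamma_{d_{\mu_i}k_\mu}\Delta_{\mathrm{pr}}(\mu)^2+\gamma_{a_\mu}\,\Delta_{\tilde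 d_{\mu_i}\mathrm{pr}}(\mu)\,\Delta_{\mathrm{du}}(\mu)+\|r_\mu^{\mathrm{du},d_{\mu_i}}(u_{r,\mu},p_{r,\mu},\tilde d_{\mu_i}u_{r,\mu},\tilde d_{\mu_i}p_{r,\mu})\|\,\Delta_{\mathrm{pr}}(\mu).$$
   Context: Setting. Let $P\in\mathbb N$, $\mu_{\mathsf a},\mu_{\mathsf b}\in\mathbb R^P$, and $\mathcal P=\{\mu\in\mathbb R^P: \mu_{\mathsf a}\le\mu\le\mu_{\mathsf b}\}$ (componentwise). $V$ is a real Hilbert space with norm $\|\cdot\|$, and $V_h\subset V$ is a finite-dimensional subspace. For each $\mu\in\mathcal P$: $a_\mu:V\times V\to\mathbb R$ is a continuous, coercive, symmetric bilinear form; $l_\mu,j_\mu\in V'$; $k_\mu:V\times V\to\mathbb R$ is a continuous symmetric bilinear form; $\Theta:\mathcal P\to\mathbb R$. All forms are parameter separable, i.e. $a_\mu=\sum_{\xi}\theta^a_\xi(\mu)a_\xi$ is a finite sum with parameter-independent components, and similarly for $l_\mu,j_\mu,k_\mu$. The cost functional is $\mathcal J(u,\mu)=\Theta(\mu)+j_\mu(u)+k_\mu(u,u)$. It is assumed that $a_\mu,l_\mu,\mathcal J$ (hence all coefficient functions) are twice Fréchet differentiable with respect to $\mu$. Notation. $d_{\mu_i}$ is the partial derivative with respect to the $i$-th component of $\mu$; $d_{\mu_i}a_\mu,d_{\mu_i}l_\mu,d_{\mu_i}j_\mu,d_{\mu_i}k_\mu$ are the forms obtained by differentiating the coefficients; $d_{\mu_i}\mathcal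 J(u,\mu)$ is the partial derivative with $u$ held fixed. Residuals: $r^{\mathrm{pr}}_\mu(u)[v]=l_\mu(v)-a_\mu(u,v)$ and $r^{\mathrm{du}}_\mu(u,p)[v]=j_\mu(v)+2k_\mu(v,u)-a_\mu(v,p)$; $d_{\mu_i}r^{\mathrm{pr}}_\mu(u)[v]=d_{\mu_i}l_\mu(v)-d_{\mu_i}a_\mu(u,v)$ and $d_{\mu_i}r^{\mathrm{du}}_\mu(u,p)[v]=d_{\mu_i}j_\mu(v)+2d_{\mu_i}k_\mu(v,u)-d_{\mu_i}a_\mu(v,p)$ (arguments $u,p,v$ held fixed, also when evaluated at $\mu$-dependent functions). Sensitivity residuals: for $u,p,u',p',v,q\in V_h$, $r^{\mathrm{pr},d_{\mu_i}}_\mu(u,u')[v]=d_{\mu_i}r^{\mathrm{pr}}_\mu(u)[v]-a_\mu(u',v)$ and $r^{\mathrm{du},d_{\mu_i}}_\mu(u,p,u',p')[q]=d_{\mu_i}r^{\mathrm{du}}_\mu(u,p)[q]+2k_\mu(q,u')-a_\mu(q,p')$. Full order model. $u_{h,\mu}\in V_h$ solves $a_\mu(u_{h,\mu},v_h)=l_\mu(v_h)$ for all $v_h\in V_h$; $\hat{\mathcal J}_h(\mu)=\mathcal J(u_{h,\mu},\mu)$. Reduced basis (RB) model. Let $V_r^{\mathrm{pr}},V_r^{\mathrm{du}}\subset V_h$ be (possibly different) linear subspaces. $u_{r,\mu}\in V_r^{\mathrm{pr}}$ solves $a_\mu(u_{r,\mu},v_r)=l_\mu(v_r)$ for all $v_r\in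 V_r^{\mathrm{pr}}$; $p_{r,\mu}\in V_r^{\mathrm{du}}$ solves $a_\mu(q_r,p_{r,\mu})=j_\mu(q_r)+2k_\mu(q_r,u_{r,\mu})$ for all $q_r\in V_r^{\mathrm{du}}$. The NCD-corrected RB reduced functional is $\hat{\mathcal J}_r(\mu)=\mathcal J(u_{r,\mu},\mu)+r^{\mathrm{pr}}_\mu(u_{r,\mu})[p_{r,\mu}]$. Reduced sensitivities. $d_{\mu_i}u_{r,\mu}\in V_r^{\mathrm{pr}}$ solves $a_\mu(d_{\mu_i}u_{r,\mu},v_r)=d_{\mu_i}r^{\mathrm{pr}}_\mu(u_{r,\mu})[v_r]$ for all $v_r\in V_r^{\mathrm{pr}}$; $d_{\mu_i}p_{r,\mu}\in V_r^{\mathrm{du}}$ solves $a_\mu(q_r,d_{\mu_i}p_{r,\mu})=d_{\mu_i}r^{\mathrm{du}}_\mu(u_{r,\mu},p_{r,\mu})[q_r]+2k_\mu(q_r,d_{\mu_i}u_{r,\mu})$ for all $q_r\in V_r^{\mathrm{du}}$. With these, the true gradient of $\hat{\mathcal J}_r$ is $(\nabla_\mu\hat{\mathcal J}_r(\mu))_i=d_{\mu_i}\mathcal J(u_{r,\mu},\mu)+d_{\mu_i}r^{\mathrm{pr}}_\mu(u_{r,\mu})[p_{r,\mu}]+r^{\mathrm{pr}}_\mu(u_{r,\mu})[d_{\mu_i}p_{r,\mu}]+r^{\mathrm{du}}_\mu(u_{r,\mu},p_{r,\mu})[d_{\mu_i}u_{r,\mu}]$. Approximate sensitivities. For each $i$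 let $V_r^{\mathrm{pr},d_{\mu_i}},V_r^{\mathrm{du},d_{\mu_i}}\subset V_h$ be further linear subspaces. $\tilde d_{\mu_i}u_{r,\mu}\in V_r^{\mathrm{pr},d_{\mu_i}}$ solves $a_\mu(\tilde d_{\mu_i}u_{r,\mu},v_r)=d_{\mu_i}r^{\mathrm{pr}}_\mu(u_{r,\mu})[v_r]$ for all $v_r\in V_r^{\mathrm{pr},d_{\mu_i}}$; $\tilde d_{\mu_i}p_{r,\mu}\in V_r^{\mathrm{du},d_{\mu_i}}$ solves $a_\mu(q_r,\tilde d_{\mu_i}p_{r,\mu})=d_{\mu_i}r^{\mathrm{du}}_\mu(u_{r,\mu},p_{r,\mu})[q_r]+2k_\mu(q_r,\tilde d_{\mu_i}u_{r,\mu})$ for all $q_r\in V_r^{\mathrm{du},d_{\mu_i}}$. The approximate gradient is $(\widetilde\nabla_\mu\hat{\mathcal J}_r(\mu))_i:=d_{\mu_i}\mathcal J(u_{r,\mu},\mu)+d_{\mu_i}r^{\mathrm{pr}}_\mu(u_{r,\mu})[p_{r,\mu}]+r^{\mathrm{pr}}_\mu(u_{r,\mu})[\tilde d_{\mu_i}p_{r,\mu}]+r^{\mathrm{du}}_\mu(u_{r,\mu},p_{r,\mu})[\tilde d_{\mu_i}u_{r,\mu}]$. Norms, constants, estimators. Norms of residuals are dual norms in $V_h'$ with respect to $\|\cdot\|$; for a functional or bilinear form $b$ on $V_h$, $\gamma_b$ is its continuity constant; $\underline{a_\mu}>0$ is the coercivity constant of $a_\mu$ on $V_h$. $\Delta_{\mathrm{pr}}(\mu)=\underline{a_\mu}^{-1}\|r^{\mathrm{pr}}_\mu(u_{r,\mu})\|$;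 $\Delta_{\mathrm{du}}(\mu)=\underline{a_\mu}^{-1}\big(2\gamma_{k_\mu}\Delta_{\mathrm{pr}}(\mu)+\|r^{\mathrm{du}}_\mu(u_{r,\mu},p_{r,\mu})\|\big)$; $\Delta_{d_{\mu_i}\mathrm{pr}}(\mu)=\underline{a_\mu}^{-1}\big(\gamma_{d_{\mu_i}a_\mu}\Delta_{\mathrm{pr}}(\mu)+\|r^{\mathrm{pr},d_{\mu_i}}_\mu(u_{r,\mu},d_{\mu_i}u_{r,\mu})\|\big)$; $\Delta_{\tilde d_{\mu_i}\mathrm{pr}}(\mu)=\underline{a_\mu}^{-1}\big(\gamma_{d_{\mu_i}a_\mu}\Delta_{\mathrm{pr}}(\mu)+\|r^{\mathrm{pr},d_{\mu_i}}_\mu(u_{r,\mu},\tilde d_{\mu_i}u_{r,\mu})\|\big)$. $\|\cdot\|_2$ is the Euclidean norm on $\mathbb R^P$. *)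

(* Defs.v *)
From HB Require Import structures.
From mathcomp Require Import all_boot all_order all_algebra.
From mathcomp Require Import all_classical all_reals all_analysis.

Set Implicit Arguments.
Unset Strict Implicit.
Unset Printing Implicit Defensive.

Import Order.TTheory GRing.Theory Num.Theory.
Import numFieldNormedType.Exports.

Local Open Scope classical_set_scope.
Local Open Scope ring_scope.

Section Calculus.
Context {R : realType} {P : nat}.
Implicit Types (D : set 'rV[R]_P) (f : 'rV[R]_P -> R) (mu : 'rV[R]_P).

Definition norm2 (x : 'rV[R]_P) : R := Num.sqrt (\sum_i x 0 i ^+ 2).

(* Derivatives are taken relative to a set D and only use the values on D, so
   that they are one-sided at the faces of a closed box.  At [nu = mu] the
   quotient below is 0 / 0 = 0. *)
Definition frechet_on D (W : normedModType R) (F : 'rV[R]_P -> W)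
    (mu : 'rV[R]_P) (L : {linear 'rV[R]_P -> W}) : Prop :=
  (`|F nu - F mu - L (nu - mu)| / `|nu - mu|) @[nu --> within D (nbhs mu)]
    --> (0 : R).

(* The first derivative, a linear form on R^P, is represented by its row of
   coefficients [Df mu]; the second derivative is the derivative of [Df]. *)
Definition twice_frechet_on D f : Prop :=
  exists Df : 'rV[R]_P -> 'rV[R]_P,
    (forall mu, D mu ->
       exists L : {linear 'rV[R]_P -> R^o},
         (forall h, L h = \sum_i Df mu 0 i * h 0 i) /\
         frechet_on D (f : 'rV[R]_P -> R^o) mu L) /\
    (forall mu, D mu ->
       exists L : {linear 'rV[R]_P -> 'rV[R]_P}, frechet_on D Df mu L).

(* Increments t <> 0 tending to 0 for which mu + t e_i stays in D. *)
Definition increments D (i : 'I_P) mu : set_system R :=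
  within [set t | D (mu + t *: delta_mx 0 i)] (0 : R)^'.

(* If mu is isolated in D along e_i (a box that is flat in direction i), the
   filter of increments is improper, every number is a limit, and the
   derivative is 0 by convention. *)
Definition partial D (i : 'I_P) f mu : R :=
  if `[< increments D i mu set0 >] then 0
  else lim ((t^-1 * (f (mu + t *: delta_mx 0 i) - f mu))
              @[t --> increments D i mu]).

Definition gradient D f mu : 'rV[R]_P := \row_i partial D i f mu.

End Calculus.

Section Spaces.
Context {R : realType} {V : normedModType R}.

Definition is_inner_product (ip : {bilinear V -> V -> R^o}) : Prop :=
  (forall u v, ip u v = ip v u) /\ (forall v, ip v v = `|v| ^+ 2).

Definition is_subspace (W : set V) : Prop :=
  W 0 /\ forall (c : R) u v, W u -> W v -> W (c *: u + v).

Definition is_finite_dim (W : set V) : Prop :=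
  exists (n : nat) (phi : 'I_n -> V),
    W = [set \sum_i c i *: phi i | c in [set: 'I_n -> R]].

Definition is_symmetric (b : V -> V -> R) : Prop := forall u v, b u v = b v u.

Definition is_coercive (b : V -> V -> R) : Prop :=
  exists2 alpha : R, 0 < alpha & forall v, alpha * `|v| ^+ 2 <= b v v.

(* On the zero space both suprema and the infimum below are over the empty set
   and hence equal 0. *)
Definition dual_norm (W : set V) (f : V -> R) : R :=
  sup [set `|f v| / `|v| | v in W `\ 0].

Definition cont_const (W : set V) (b : V -> V -> R) : R :=
  sup [set `|b z.1 z.2| / (`|z.1| * `|z.2|) | z in (W `\ 0) `*` (W `\ 0)].

Definition coer_const (W : set V) (b : V -> V -> R) : R :=
  inf [set b v v / `|v| ^+ 2 | v in W `\ 0].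

End Spaces.

(* The parameter box, and the parameter-separable forms given by their
   coefficient functions [th_*] and parameter-independent components [c_*].
   Only the values of the coefficient functions on the box are ever used. *)
Record problem (R : realType) (V : normedModType R) (P : nat) := Problem {
  mu_a : 'rV[R]_P;
  mu_b : 'rV[R]_P;
  n_a : nat;
  th_a : 'I_n_a -> 'rV[R]_P -> R;
  c_a : 'I_n_a -> {bilinear V -> V -> R^o};
  n_l : nat;
  th_l : 'I_n_l -> 'rV[R]_P -> R;
  c_l : 'I_n_l -> {linear V -> R^o};
  n_j : nat;
  th_j : 'I_n_j -> 'rV[R]_P -> R;
  c_j : 'I_n_j -> {linear V -> R^o};
  n_k : nat;
  th_k : 'I_n_k -> 'rV[R]_P -> R;
  c_k : 'I_n_k -> {bilinear V -> V -> R^o};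
  Theta : 'rV[R]_P -> R
}.

Arguments mu_a {R V P} pb : rename.
Arguments mu_b {R V P} pb : rename.
Arguments n_a {R V P} pb : rename.
Arguments th_a {R V P} pb _ : rename.
Arguments c_a {R V P} pb _ : rename.
Arguments n_l {R V P} pb : rename.
Arguments th_l {R V P} pb _ : rename.
Arguments c_l {R V P} pb _ : rename.
Arguments n_j {R V P} pb : rename.
Arguments th_j {R V P} pb _ : rename.
Arguments c_j {R V P} pb _ : rename.
Arguments n_k {R V P} pb : rename.
Arguments th_k {R V P} pb _ : rename.
Arguments c_k {R V P} pb _ : rename.
Arguments Theta {R V P} pb : rename.

Section Model.
Context {R : realType} {V : normedModType R} {P : nat}.
Variable pb : problem V P.
Implicit Types (mu : 'rV[R]_P) (i : 'I_P) (u v p q : V) (Vh W : set V).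

Definition box : set 'rV[R]_P :=
  [set mu | forall i, mu_a pb 0 i <= mu 0 i <= mu_b pb 0 i].

Definition a_mu mu u v : R := \sum_x th_a pb x mu * c_a pb x u v.
Definition l_mu mu v : R := \sum_x th_l pb x mu * c_l pb x v.
Definition j_mu mu v : R := \sum_x th_j pb x mu * c_j pb x v.
Definition k_mu mu u v : R := \sum_x th_k pb x mu * c_k pb x u v.

Definition d_a i mu u v : R := \sum_x partial box i (th_a pb x) mu * c_a pb x u v.
Definition d_l i mu v : R := \sum_x partial box i (th_l pb x) mu * c_l pb x v.
Definition d_j i mu v : R := \sum_x partial box i (th_j pb x) mu * c_j pb x v.
Definition d_k i mu u v : R := \sum_x partial box i (th_k pb x) mu * c_k pb x u v.

Record standing_assumptions : Prop := {
  a_cont : forall x, continuous (fun z : V * V => c_a pb x z.1 z.2 : R^o);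
  l_cont : forall x, continuous (c_l pb x : V -> R^o);
  j_cont : forall x, continuous (c_j pb x : V -> R^o);
  k_cont : forall x, continuous (fun z : V * V => c_k pb x z.1 z.2 : R^o);
  a_sym : forall mu, box mu -> is_symmetric (a_mu mu);
  a_coer : forall mu, box mu -> is_coercive (a_mu mu);
  k_sym : forall mu, box mu -> is_symmetric (k_mu mu);
  a_diff : forall x, twice_frechet_on box (th_a pb x);
  l_diff : forall x, twice_frechet_on box (th_l pb x);
  j_diff : forall x, twice_frechet_on box (th_j pb x);
  k_diff : forall x, twice_frechet_on box (th_k pb x);
  Theta_diff : twice_frechet_on box (Theta pb)
}.

Definition cost u mu : R := Theta pb mu + j_mu mu u + k_mu mu u u.
Definition d_cost i u mu : R := partial box i (cost u) mu.

Definition r_pr mu u v : R := l_mu mu v - a_mu mu u v.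
Definition r_du mu u p v : R := j_mu mu v + 2 * k_mu mu v u - a_mu mu v p.
Definition d_r_pr i mu u v : R := d_l i mu v - d_a i mu u v.
Definition d_r_du i mu u p v : R := d_j i mu v + 2 * d_k i mu v u - d_a i mu v p.

Definition sens_r_pr i mu u u' v : R := d_r_pr i mu u v - a_mu mu u' v.
Definition sens_r_du i mu u p u' p' q : R :=
  d_r_du i mu u p q + 2 * k_mu mu q u' - a_mu mu q p'.

(* The four Galerkin problems on a subspace W. *)
Definition solves_pr W mu u : Prop :=
  W u /\ forall v, W v -> a_mu mu u v = l_mu mu v.
Definition solves_du W mu u p : Prop :=
  W p /\ forall q, W q -> a_mu mu q p = j_mu mu q + 2 * k_mu mu q u.
Definition solves_sens_pr W i mu u u' : Prop :=
  W u' /\ forall v, W v -> a_mu mu u' v = d_r_pr i mu u v.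
Definition solves_sens_du W i mu u p u' p' : Prop :=
  W p' /\ forall q, W q -> a_mu mu q p' = d_r_du i mu u p q + 2 * k_mu mu q u'.

Definition J_h (u_h : 'rV[R]_P -> V) mu : R := cost (u_h mu) mu.
Definition J_r (u_r p_r : 'rV[R]_P -> V) mu : R :=
  cost (u_r mu) mu + r_pr mu (u_r mu) (p_r mu).

Definition sens_gradient mu u p (u' p' : 'I_P -> V) : 'rV[R]_P :=
  \row_i (d_cost i u mu + d_r_pr i mu u p + r_pr mu u (p' i) + r_du mu u p (u' i)).

Definition Delta_pr Vh mu u : R :=
  (coer_const Vh (a_mu mu))^-1 * dual_norm Vh (r_pr mu u).
Definition Delta_du Vh mu u p : R :=
  (coer_const Vh (a_mu mu))^-1 *
  (2 * cont_const Vh (k_mu mu) * Delta_pr Vh mu u + dual_norm Vh (r_du mu u p)).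
Definition Delta_sens_pr Vh i mu u u' : R :=
  (coer_const Vh (a_mu mu))^-1 *
  (cont_const Vh (d_a i mu) * Delta_pr Vh mu u + dual_norm Vh (sens_r_pr i mu u u')).

Definition Delta_gradient Vh mu u p (u' p' : 'I_P -> V) : 'rV[R]_P :=
  \row_i (cont_const Vh (d_k i mu) * Delta_pr Vh mu u ^+ 2
          + cont_const Vh (a_mu mu) * Delta_sens_pr Vh i mu u (u' i) * Delta_du Vh mu u p
          + dual_norm Vh (sens_r_du i mu u p (u' i) (p' i)) * Delta_pr Vh mu u).

End Model.

(* Main.v *)
Require Import Defs.
From HB Require Import structures.
From mathcomp Require Import all_boot all_order all_algebra.
From mathcomp Require Import all_classical all_reals all_analysis.
From mathcomp Require Import ring lra.
Import Order.TTheory GRing.Theory Num.Theory.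
Import numFieldNormedType.Exports.
Local Open Scope classical_set_scope.
Local Open Scope ring_scope.

(** The full order functional is itself an NCD-corrected functional: if [p_h] is
    the full order adjoint, the correction [r_pr(u_h)(p_h)] vanishes.  Hence one
    differentiability result covers both gradients: Galerkin solutions inherit
    the derivative of the parameter-separable data because the forms are
    coercive, and differentiating the functional term by term gives the
    sensitivity formula.  In a direction in which the box is flat, all
    coefficient derivatives are 0 by convention, so by coercivity the
    sensitivities and both sides of the formula vanish too.

    The difference of the gradients then reduces algebraically, with
    [e = u_h - u_r] and [eps = p_h - p_r], to
    [d_k(e, e) + sens_r_du(e) + a(d u_h - u', eps)], for arbitrary [u'], [p'] in
    [V_h] in place of the reduced sensitivities.  This is why the same estimate
    holds for the approximate gradient; each factor is bounded by coercivity. *)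

Set Implicit Arguments.
Unset Strict Implicit.
Unset Printing Implicit Defensive.

(** * Bounded linear and bilinear forms *)

Section BoundedForms.
Context {R : realType} {V : normedModType R}.
Implicit Types (f : V -> R) (b : V -> V -> R) (W : set V) (u v w : V) (c : R).

(** Residuals and forms such as [a_mu] and [d_a] are plain functions, not bundled linear maps;
    linearity and a norm bound are therefore carried as a predicate. *)
Record bounded_functional f : Prop := BoundedFunctional {
  bf_lin : forall c u v, f (c *: u + v) = c * f u + f v;
  bf_bound : exists2 C, 0 <= C & forall u, `|f u| <= C * `|u| }.

Record bounded_bilinear b : Prop := BoundedBilinear {
  bb_linl : forall c u u' v, b (c *: u + u') v = c * b u v + b u' v;
  bb_linr : forall c u v v', b u (c *: v + v') = c * b u v + b u v';
  bb_bound : exists2 C, 0 <= C & forall u v, `|b u v| <= C * `|u| * `|v| }.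

(** The dual problem has its unknown in the second argument; flipping the form gives it the shape of
    a primal problem, so one existence and one differentiability result serve both. *)
Definition flip b u v := b v u.

Lemma flip_bounded_bilinear b : bounded_bilinear b -> bounded_bilinear (flip b).
Proof.
case=> bl br [C C0 bC]; split=> [c u u' v|c u v v'|]; first exact: br.
  exact: bl.
by exists C => // u v; rewrite mulrAC; exact: bC.
Qed.

Lemma bfD f u v : bounded_functional f -> f (u + v) = f u + f v.
Proof. by move=> hf; rewrite -[u in LHS]scale1r (bf_lin hf) mul1r. Qed.

Lemma bf0 f : bounded_functional f -> f 0 = 0.
Proof. by move=> hf; apply: (addrI (f 0)); rewrite -bfD// !addr0. Qed.

Lemma bfZ f c u : bounded_functional f -> f (c *: u) = c * f u.
Proof. by move=> hf; rewrite -[c *: u]addr0 (bf_lin hf) bf0// addr0. Qed.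

Lemma bfN f u : bounded_functional f -> f (- u) = - f u.
Proof. by move=> hf; rewrite -scaleN1r bfZ// mulN1r. Qed.

Lemma bfB f u v : bounded_functional f -> f (u - v) = f u - f v.
Proof. by move=> hf; rewrite bfD// bfN. Qed.

Lemma bf_sum f (I : finType) (F : I -> V) :
  bounded_functional f -> f (\sum_i F i) = \sum_i f (F i).
Proof.
move=> hf; apply: (big_morph f) => [u v|]; [exact: bfD|exact: bf0].
Qed.

Lemma bb_functionall b v : bounded_bilinear b -> bounded_functional (b ^~ v).
Proof.
case=> bl _ [C C0 bC]; split=> [c u u'|]; first exact: bl.
by exists (C * `|v|) => [|u]; rewrite ?mulr_ge0// mulrAC.
Qed.

Lemma bb_functionalr b u : bounded_bilinear b -> bounded_functional (b u).
Proof. by move/flip_bounded_bilinear/(bb_functionall u). Qed.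

Lemma bbBl b u u' v : bounded_bilinear b -> b (u - u') v = b u v - b u' v.
Proof. by move/(bb_functionall v)/bfB; apply. Qed.
Lemma bbBr b u v v' : bounded_bilinear b -> b u (v - v') = b u v - b u v'.
Proof. by move/(bb_functionalr u)/bfB; apply. Qed.
Lemma bb0l b v : bounded_bilinear b -> b 0 v = 0.
Proof. by move/(bb_functionall v)/bf0. Qed.
Lemma bb0r b u : bounded_bilinear b -> b u 0 = 0.
Proof. by move/(bb_functionalr u)/bf0. Qed.
Lemma bbZl b c u v : bounded_bilinear b -> b (c *: u) v = c * b u v.
Proof. by move/(bb_functionall v)/bfZ; apply. Qed.

Lemma bounded_functionalD f g : bounded_functional f -> bounded_functional g ->
  bounded_functional (fun v => f v + g v).
Proof.
case=> fl [C C0 fC] [gl [D D0 gD]]; split=> [c u v|].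
  by rewrite fl gl; ring.
exists (C + D) => [|u]; first exact: addr_ge0.
by rewrite mulrDl (le_trans (ler_normD _ _))// lerD.
Qed.

Lemma bounded_functionalZ c f : bounded_functional f ->
  bounded_functional (fun v => c * f v).
Proof.
case=> fl [C C0 fC]; split=> [d u v|]; first by rewrite fl; ring.
by exists (`|c| * C) => [|u]; rewrite ?mulr_ge0// normrM -mulrA ler_wpM2l.
Qed.

Lemma bounded_functionalB f g : bounded_functional f -> bounded_functional g ->
  bounded_functional (fun v => f v - g v).
Proof.
move=> hf /(bounded_functionalZ (-1)) hg.
have := bounded_functionalD hf hg.
by congr bounded_functional; apply/funext => v; rewrite mulN1r.
Qed.

Lemma bounded_functional_sum n (th : 'I_n -> R) (F : 'I_n -> V -> R) :
  (forall x, bounded_functional (F x)) ->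
  bounded_functional (fun v => \sum_x th x * F x v).
Proof.
move=> hF; split=> [c u v|].
  rewrite mulr_sumr -big_split; apply: eq_bigr => x _.
  by rewrite (bf_lin (hF x)) /=; ring.
have /choice[C hC] : forall x, exists C, 0 <= C /\ forall u, `|F x u| <= C * `|u|.
  by move=> x; have [C C0 FC] := bf_bound (hF x); exists C.
exists (\sum_x `|th x| * C x) => [|u].
  by apply: sumr_ge0 => x _; rewrite mulr_ge0//; case: (hC x).
rewrite mulr_suml (le_trans (ler_norm_sum _ _ _))//; apply: ler_sum => x _.
by rewrite normrM -mulrA ler_wpM2l//; case: (hC x).
Qed.

Lemma bounded_bilinear_sum n (th : 'I_n -> R) (F : 'I_n -> V -> V -> R) :
  (forall x, bounded_bilinear (F x)) ->
  bounded_bilinear (fun u v => \sum_x th x * F x u v).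
Proof.
move=> hF; split=> [c u u' v|c u v v'|].
- rewrite mulr_sumr -big_split; apply: eq_bigr => x _.
  by rewrite (bb_linl (hF x)) /=; ring.
- rewrite mulr_sumr -big_split; apply: eq_bigr => x _.
  by rewrite (bb_linr (hF x)) /=; ring.
have /choice[C hC] : forall x, exists C,
    0 <= C /\ forall u v, `|F x u v| <= C * `|u| * `|v|.
  by move=> x; have [C C0 FC] := bb_bound (hF x); exists C.
exists (\sum_x `|th x| * C x) => [|u v].
  by apply: sumr_ge0 => x _; rewrite mulr_ge0//; case: (hC x).
rewrite !mulr_suml (le_trans (ler_norm_sum _ _ _))//; apply: ler_sum => x _.
by rewrite normrM -!mulrA ler_wpM2l// mulrA; case: (hC x).
Qed.

Lemma continuous_bounded_functional (f : {linear V -> R^o}) :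
  continuous (f : V -> R^o) -> bounded_functional f.
Proof.
move=> /linear_bounded_continuous/linear_boundedP cf; split=> [c u v|].
  by rewrite linearP.
have [r [_ hr]] := cf.
exists (Num.max (r + 1) 0) => [|u]; first by rewrite le_max lexx orbT.
apply: (le_trans (hr (r + 1) _ u)); first by rewrite ltrDl.
by rewrite ler_wpM2r// le_max lexx.
Qed.

(** Only continuity at the origin enters: it bounds [b] by 1 on a product of two balls of radius
    [d], and rescaling both arguments does the rest. *)
Lemma continuous_bounded_bilinear (b : {bilinear V -> V -> R^o}) :
  continuous (fun z : V * V => b z.1 z.2 : R^o) -> bounded_bilinear b.
Proof.
move=> cb; split=> [c u u' v|c u v v'|]; first by rewrite linearPl.
  by rewrite linearPr.
have cb0 : b z.1 z.2 @[z --> ((0, 0) : V * V)] --> (0 : R^o).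
  by have := cb (0, 0); rewrite /continuous_at /= linear0r.
have : filter_prod (nbhs (0 : V)) (nbhs (0 : V)) [set z | `|b z.1 z.2 : R| < 1].
  have /cvgrPdist_lt/(_ 1 ltr01) := cb0; apply: filterS => z /=.
  by rewrite sub0r normrN.
move=> [[A B] [/= nA nB] hAB].
have [d1 /= d10 hA] := (@nbhs_norm0P R V _).1 nA.
have [dv /= d20 hB] := (@nbhs_norm0P R V _).1 nB.
pose d : R := Num.min d1 dv.
have d0 : 0 < d by rewrite lt_min d10.
have hb u v : `|u| < d -> `|v| < d -> `|b u v : R| < 1.
  rewrite !lt_min => /andP[ud _] /andP[_ vd].
  by apply: (hAB (u, v)); split; [exact: hA|exact: hB].
have d2 : 0 < d / 2 by rewrite divr_gt0.
(* Nonzero arguments are rescaled to norm [d / 2], strictly inside the ball; undoing both scalings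
   yields this constant. *)
exists ((d / 2) ^- 2) => [|u v]; first by rewrite invr_ge0 exprn_ge0// ltW.
have [->|u0] := eqVneq u 0; first by rewrite linear0l !normr0 mulr0 mul0r.
have [->|v0] := eqVneq v 0; first by rewrite linear0r !normr0 mulr0.
have nu : 0 < `|u| by rewrite normr_gt0.
have nv : 0 < `|v| by rewrite normr_gt0.
have small w : w != 0 -> `|(d / 2 / `|w|) *: w| < d.
  move=> w0; have nw : 0 < `|w| by rewrite normr_gt0.
  rewrite normrZ normf_div normr_id gtr0_norm// divfK ?gt_eqF//.
  by rewrite ltr_pdivrMr// ltr_pMr// ltr1n.
have := hb _ _ (small _ u0) (small _ v0).
rewrite linearZl_LR linearZr_LR => /ltW h.
have {h} : `|(d / 2 / `|u|) * ((d / 2 / `|v|) * (b u v : R))| <= 1 by exact: h.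
rewrite mulrA normrM (gtr0_norm (mulr_gt0 (divr_gt0 d2 nu) (divr_gt0 d2 nv))) => h.
rewrite -mulrA -ler_pdivrMr ?mulr_gt0//.
rewrite -[X in _ <= X]mulr1 -ler_pdivrMl ?invr_gt0 ?exprn_gt0// invrK.
apply: le_trans h; rewrite le_eqVlt; apply/orP; left; apply/eqP.
by field; rewrite !gt_eqF.
Qed.

(* The right-hand side [j |-> f (phi j)] vanishes on the kernel of the Gram
   matrix because [b w w = 0] forces [w = 0] there. *)
Lemma lax_milgram_finite_dim W b f : is_finite_dim W -> bounded_bilinear b ->
  is_coercive b -> bounded_functional f ->
  exists2 u, W u & forall v, W v -> b u v = f v.
Proof.
move=> [n [phi ->]] hb [al al0 co] hf.
pose M : 'M[R]_n := \matrix_(i, j) b (phi i) (phi j).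
pose F : 'rV[R]_n := \row_j f (phi j).
(* The family [phi] spans [W] but may be linearly dependent, so [M] can be singular; solvability of
   [c *m M = F] is tested against the cokernel. *)
have /submxP[c Fc] : (F <= M)%MS.
  rewrite submxE; apply/eqP/rowP => k; rewrite !mxE.
  set K := cokermx M.
  pose w := \sum_j K j k *: phi j.
  have bw i : b (phi i) w = 0.
    have /matrixP/(_ i k) := mulmx_coker M; rewrite !mxE; apply: etrans.
    rewrite (bf_sum _ (bb_functionalr (phi i) hb)); apply: eq_bigr => j _.
    by rewrite (bfZ _ _ (bb_functionalr _ hb)) [M i j]mxE mulrC.
  have bww : b w w = 0.
    rewrite {1}/w (bf_sum _ (bb_functionall _ hb)) big1// => j _.
    by rewrite bbZl// bw mulr0.
  have w0 : w = 0.
    apply/eqP; rewrite -normr_le0 -(@ler_sqr _ `|w| 0) ?nnegrE//.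
    by rewrite expr0n -(ler_pM2l al0) mulr0 -bww.
  transitivity (f w); last by rewrite w0 bf0.
  rewrite (bf_sum _ hf); apply: eq_bigr => j _.
  by rewrite mxE bfZ// mulrC.
exists (\sum_i c 0 i *: phi i); first by exists (c 0).
move=> _ [d _ <-]; rewrite !(bf_sum _ (bb_functionalr _ hb)) (bf_sum _ hf).
apply: eq_bigr => j _; rewrite (bfZ _ _ (bb_functionalr _ hb)) bfZ//.
have /rowP/(_ j) := Fc; rewrite !mxE => ->; congr (_ * _).
rewrite (bf_sum _ (bb_functionall _ hb)); apply: eq_bigr => i _.
by rewrite bbZl// mxE.
Qed.

(** * Dual norms, continuity constants and the coercivity constant *)

Lemma sup_ge0 (E : set R) : (forall x, E x -> 0 <= x) -> 0 <= sup E.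
Proof.
(* For an empty or unbounded set [sup] has the default value 0. *)
move=> E0; have [[[x Ex] ubE]|/sup_out ->//] := pselect (has_sup E).
exact: le_trans (E0 x Ex) (ub_le_sup ubE Ex).
Qed.

Lemma dual_norm_ge0 W f : 0 <= dual_norm W f.
Proof. by apply: sup_ge0 => _ [v _ <-]; rewrite divr_ge0. Qed.

Lemma cont_const_ge0 W b : 0 <= cont_const W b.
Proof. by apply: sup_ge0 => _ [z _ <-]; rewrite divr_ge0// mulr_ge0. Qed.

(** Boundedness of [f] bounds the set of quotients from above, so that [dual_norm] is a genuine
    supremum; [v = 0] is not among the quotients and is treated apart. *)
Lemma le_dual_norm W f v : bounded_functional f -> W v ->
  `|f v| <= dual_norm W f * `|v|.
Proof.
move=> hf Wv; have [->|v0] := eqVneq v 0; first by rewrite bf0// !normr0 mulr0.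
have nv : 0 < `|v| by rewrite normr_gt0.
rewrite -ler_pdivrMr//; apply: ub_le_sup; last first.
  by exists v => //; split => //; exact/eqP.
have [C C0 fC] := bf_bound hf; exists C => _ [u [_ /eqP u0] <-].
by rewrite ler_pdivrMr// normr_gt0.
Qed.

Lemma le_cont_const W b u v : bounded_bilinear b -> W u -> W v ->
  `|b u v| <= cont_const W b * `|u| * `|v|.
Proof.
move=> hb Wu Wv.
have [->|u0] := eqVneq u 0; first by rewrite bb0l// !normr0 mulr0 mul0r.
have [->|v0] := eqVneq v 0; first by rewrite bb0r// !normr0 mulr0.
have nuv : 0 < `|u| * `|v| by rewrite mulr_gt0// normr_gt0.
rewrite -mulrA -ler_pdivrMr//; apply: ub_le_sup; last first.
  by exists (u, v) => //; split; split => //; exact/eqP.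
have [C C0 fC] := bb_bound hb; exists C => _ [z [[_ /eqP z1] [_ /eqP z2]] <-].
by rewrite ler_pdivrMr ?mulrA// mulr_gt0// normr_gt0.
Qed.

(** Every error bound below has this form: an error tested with itself. If [w] is nonzero, the
    infimum is at least [al > 0], and one factor [|w|] cancels. *)
Lemma le_coer_const W b w B : is_coercive b -> W w -> 0 <= B ->
  b w w <= B * `|w| -> `|w| <= (coer_const W b)^-1 * B.
Proof.
move=> [al al0 co] Ww B0 bw.
have lb : lbound [set b v v / `|v| ^+ 2 | v in W `\ 0] al.
  move=> _ [v [_ /eqP v0] <-].
  by rewrite ler_pdivlMr// exprn_gt0// normr_gt0.
(* For [w = 0] only the sign of the constant matters; if [W] has no nonzero vector, the infimum of
   the empty set is 0, and so is its inverse. *)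
have [w0|w0] := eqVneq w 0.
  rewrite w0 normr0 mulr_ge0// invr_ge0.
  rewrite /coer_const; set E := [set _ | _ in _] in lb *.
  have [/lb_le_inf/(_ lb)/(le_trans (ltW al0))//|/nonemptyPn ->] :=
    pselect (E !=set0).
  by rewrite inf0.
have nw : 0 < `|w| by rewrite normr_gt0.
have Sw : [set b v v / `|v| ^+ 2 | v in W `\ 0] (b w w / `|w| ^+ 2).
  by exists w => //; split => //; exact/eqP.
have c0 : 0 < coer_const W b.
  by apply: (lt_le_trans al0); apply: lb_le_inf => //; exists (b w w / `|w| ^+ 2).
have : coer_const W b <= b w w / `|w| ^+ 2 by apply: ge_inf => //; exists al.
rewrite ler_pdivlMr ?exprn_gt0// => /le_trans/(_ bw).
by rewrite expr2 mulrA ler_pM2r// mulrC ler_pdivlMl// mulrC.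
Qed.

End BoundedForms.

(** * Difference quotients along a coordinate direction *)

Section Dominated.
Context {R : realType} {T : Type} {F : set_system T} {FF : Filter F}.

Lemma cvg_dominated (W : normedModType R) (f : T -> W) l (g : T -> R) :
  g @ F --> 0 -> (\forall t \near F, `|f t - l| <= g t) -> f @ F --> l.
Proof.
move=> /cvgrPdist_lt g0 fg; apply/cvgrPdist_lt => e e0.
apply: filterS2 (g0 e e0) fg => t; rewrite sub0r normrN => ge fe.
by rewrite distrC (le_lt_trans fe)// (le_lt_trans (ler_norm _)).
Qed.

Lemma cvg_dist0 (W : normedModType R) (f : T -> W) l : f @ F --> l ->
  `|f t - l| @[t --> F] --> (0 : R).
Proof.
move=> fl; rewrite -(normr0 W) -(subrr l).
by apply: cvg_norm; apply: cvgB => //; exact: cvg_cst.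
Qed.

Lemma cvg_bilinear (V : normedModType R) (b : V -> V -> R) (u v : T -> V) u0 v0 :
  bounded_bilinear b -> u @ F --> u0 -> v @ F --> v0 ->
  b (u t) (v t) @[t --> F] --> b u0 v0.
Proof.
move=> hb hu hv; have [C C0 bC] := bb_bound hb.
apply: (@cvg_dominated R^o _ _
  (fun t => C * `|u t - u0| * `|v t| + C * `|u0| * `|v t - v0|)).
  have : C * `|u t - u0| * `|v t| + C * `|u0| * `|v t - v0| @[t --> F] -->
      C * 0 * `|v0| + C * `|u0| * 0.
    apply: cvgD; apply: cvgM; [| exact: cvg_norm | exact: cvg_cst | exact: cvg_dist0].
    by apply: cvgM; [exact: cvg_cst|exact: cvg_dist0].
  by rewrite !(mulr0, mul0r, addr0).
(* Inserting [b u0 (v t)] splits the difference into [b (u t - u0) (v t)] and [b u0 (v t - v0)]. *)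
apply: nearW => t; rewrite -(subrK (b u0 (v t)) (b (u t) (v t))) -addrA.
rewrite -bbBl// -bbBr// (le_trans (ler_normD _ _))//.
exact: lerD.
Qed.

End Dominated.

Section DifferenceQuotients.
Context {R : realType} {P : nat}.
Variables (D : set 'rV[R]_P) (i : 'I_P) (mu : 'rV[R]_P).

Let G := increments D i mu.
Let shift t := mu + t *: delta_mx 0 i.

(** [G] is improper when [D] leaves no room along [e_i]; uniqueness of limits enters only in
    [partialE], under [~ G set0]. *)
#[local] Instance increments_filter : Filter G.
Proof. exact: within_filter. Qed.

Lemma near_increments : \forall t \near G, D (shift t) /\ t != 0.
Proof.
by apply: (@nearW R (nbhs 0)) => t t0 Dt.
Qed.

Lemma cvg_increments : t @[t --> G] --> (0 : R).
Proof.
apply: cvg_trans (_ : t @[t --> (0 : R)^'] --> (0 : R)).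
  by apply: cvg_app; exact: cvg_within.
exact: cvg_within.
Qed.

(** A relation rather than a value, so that the calculus rules apply to vector-valued maps and
    involve no default value of [lim]. *)
Definition has_partial (W : normedModType R) (F : 'rV[R]_P -> W) (dF : W) : Prop :=
  (t^-1 *: (F (shift t) - F mu)) @[t --> G] --> dF.

Section Vector.
Context {W : normedModType R}.
Implicit Types (F : 'rV[R]_P -> W) (dF : W).

(** For [t != 0], the value at [shift t] is [F mu] plus [t] times the difference quotient, and the
    quotient converges. *)
Lemma has_partial_cvg F dF : has_partial F dF -> F (shift t) @[t --> G] --> F mu.
Proof.
move=> hF.
have : F mu + t *: (t^-1 *: (F (shift t) - F mu)) @[t --> G] --> F mu + 0 *: dF.
  by apply: cvgD; [exact: cvg_cst|apply: cvgZ => //; exact: cvg_increments].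
rewrite scale0r addr0; apply: cvg_trans; apply: near_eq_cvg.
apply: filterS near_increments => t [_ t0].
by rewrite scalerA divff// scale1r addrC subrK.
Qed.

(** This transfers identities known on the box only, such as the symmetry of [k_mu], to
    derivatives. *)
Lemma eq_has_partial F F' dF : D mu -> {in D, F =1 F'} ->
  has_partial F dF -> has_partial F' dF.
Proof.
move=> Dmu FF' h; apply: cvg_trans h; apply: near_eq_cvg.
apply: filterS near_increments => t [Dt _].
by rewrite !FF' ?inE.
Qed.

Lemma has_partialD F F' dF dF' : has_partial F dF -> has_partial F' dF' ->
  has_partial (fun nu => F nu + F' nu) (dF + dF').
Proof.
move=> h h'; apply: cvg_trans (cvgD h h'); apply: near_eq_cvg.
by apply: nearW => t; rewrite fctE -scalerDr opprD addrACA.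
Qed.

Lemma has_partialB F F' dF dF' : has_partial F dF -> has_partial F' dF' ->
  has_partial (fun nu => F nu - F' nu) (dF - dF').
Proof.
move=> h h'; apply: cvg_trans (cvgB h h'); apply: near_eq_cvg.
by apply: nearW => t; rewrite fctE -scalerBr !opprD !opprK addrACA.
Qed.

Lemma has_partial_cst (w : W) : has_partial (fun=> w) 0.
Proof.
rewrite /has_partial; under eq_fun do rewrite subrr scaler0.
exact: cvg_cst.
Qed.

Lemma has_partial_sum n (F : 'I_n -> 'rV[R]_P -> W) (dF : 'I_n -> W) :
  (forall x, has_partial (F x) (dF x)) ->
  has_partial (fun nu => \sum_x F x nu) (\sum_x dF x).
Proof.
move=> h; have -> : (fun nu => \sum_x F x nu) = \sum_x F x.
  by apply/funext => nu; rewrite fct_sumE.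
elim/big_ind2 : _ => // [|? ? ? ?].
  exact: has_partial_cst.
exact: has_partialD.
Qed.

End Vector.

Section Value.
Context {V : normedModType R}.
Implicit Types (f : V -> R) (b : V -> V -> R) (u v : 'rV[R]_P -> V).

Lemma has_partial_functional f u du : bounded_functional f -> has_partial u du ->
  has_partial (W := R^o) (fun nu => f (u nu)) (f du).
Proof.
move=> hf hu; have [C C0 fC] := bf_bound hf.
apply: (cvg_dominated (g :=
  fun t => C * `|t^-1 *: (u (shift t) - u mu) - du|)).
  rewrite -(mulr0 C); apply: cvgM; first exact: cvg_cst.
  exact: cvg_dist0.
apply: nearW => t; apply: le_trans (fC _).
by rewrite (bfB _ _ hf) (bfZ _ _ hf) (bfB _ _ hf).
Qed.

(** The quotient splits into one term with [v (shift t)] and one with [u mu]; the first converges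
    because differentiability of [v] implies its continuity along the increments. *)
Lemma has_partial_bilinear b u v du dv : bounded_bilinear b ->
  has_partial u du -> has_partial v dv ->
  has_partial (W := R^o) (fun nu => b (u nu) (v nu)) (b du (v mu) + b (u mu) dv).
Proof.
move=> hb hu hv.
have : (b (t^-1 *: (u (shift t) - u mu)) (v (shift t)) +
    b (u mu) (t^-1 *: (v (shift t) - v mu))) @[t --> G] -->
    (b du (v mu) + b (u mu) dv).
  apply: cvgD.
    by apply: (cvg_bilinear hb); [exact: hu|exact: has_partial_cvg hv].
  by apply: (cvg_bilinear hb); [exact: cvg_cst|exact: hv].
apply: cvg_trans; apply: near_eq_cvg; apply: nearW => t.
rewrite /GRing.scale /= bbZl// (bfZ _ _ (bb_functionalr _ hb)) -mulrDr bbBl// bbBr//.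
by rewrite addrA subrK.
Qed.

End Value.

Lemma bounded_bilinear_mul : bounded_bilinear (fun x y : R^o => x * y : R).
Proof.
split=> [c u u' v|c u v v'|].

- by rewrite /GRing.scale /=; ring.
- by rewrite /GRing.scale /=; ring.
by exists 1 => // u v; rewrite mul1r normrM.
Qed.

Lemma has_partialM (f g : 'rV[R]_P -> R) df dg :
  has_partial (W := R^o) f df -> has_partial (W := R^o) g dg ->
  has_partial (W := R^o) (fun nu => f nu * g nu) (df * g mu + f mu * dg).
Proof. exact: (has_partial_bilinear bounded_bilinear_mul). Qed.

(** * Derivatives of parameter-separable forms *)

Section Separable.
Context {V : normedModType R} {n : nat}.
Variables (th : 'I_n -> 'rV[R]_P -> R) (dth : 'I_n -> R).
Hypothesis dthE : forall x, has_partial (W := R^o) (th x) (dth x).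

Lemma has_partial_separable_functional (c : 'I_n -> V -> R) u du :
  (forall x, bounded_functional (c x)) -> has_partial u du ->
  has_partial (W := R^o) (fun nu => \sum_x th x nu * c x (u nu))
    (\sum_x dth x * c x (u mu) + \sum_x th x mu * c x du).
Proof.
move=> hc hu; rewrite -big_split /=; apply: (has_partial_sum (W := R^o)) => x.
by apply: has_partialM => //; exact: has_partial_functional.
Qed.

Lemma has_partial_separable_bilinear (c : 'I_n -> V -> V -> R) u v du dv :
  (forall x, bounded_bilinear (c x)) -> has_partial u du -> has_partial v dv ->
  has_partial (W := R^o) (fun nu => \sum_x th x nu * c x (u nu) (v nu))
    (\sum_x dth x * c x (u mu) (v mu)
     + (\sum_x th x mu * c x du (v mu) + \sum_x th x mu * c x (u mu) dv)).
Proof.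
move=> hc hu hv; rewrite -!big_split /=; apply: (has_partial_sum (W := R^o)) => x.
rewrite -mulrDr; apply: has_partialM => //; exact: has_partial_bilinear.
Qed.

End Separable.

(** Differentiability with a rate [g] uniform in [v], that is, in the dual norm on [V]. Uniformity
    is essential because the Galerkin argument tests with vectors that depend on [t]. *)
Definition functional_partial {V : normedModType R} (f : 'rV[R]_P -> V -> R)
    (df : V -> R) :=
  exists2 g : R -> R, g @ G --> 0 & \forall t \near G, forall v,
    `|t^-1 * (f (shift t) v - f mu v) - df v| <= g t * `|v|.

Definition bilinear_partial {V : normedModType R} (b : 'rV[R]_P -> V -> V -> R)
    (db : V -> V -> R) :=
  exists2 g : R -> R, g @ G --> 0 & \forall t \near G, forall u v,
    `|t^-1 * (b (shift t) u v - b mu u v) - db u v| <= g t * `|u| * `|v|.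

Section Uniform.
Context {V : normedModType R} {n : nat}.
Variables (th : 'I_n -> 'rV[R]_P -> R) (dth : 'I_n -> R).
Hypothesis dthE : forall x, has_partial (W := R^o) (th x) (dth x).

(** With [C x] a bound for the component [x], this sum is the uniform rate for a separable form. *)
Lemma separable_rate (C : 'I_n -> R) :
  (\sum_x `|t^-1 * (th x (shift t) - th x mu) - dth x| * C x) @[t --> G] --> 0.
Proof.
suff : \sum_x `|t^-1 * (th x (shift t) - th x mu) - dth x| * C x @[t --> G] -->
    \sum_x `|dth x - dth x| * C x.
  by rewrite [X in _ --> X]big1// => x _; rewrite subrr normr0 mul0r.
apply: (@cvg_big R^o _ +%R) => [|x _]; first exact: add_continuous.
apply: cvgM; last exact: cvg_cst.
apply: (@cvg_norm R R^o); apply: cvgB; last exact: cvg_cst.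
exact: dthE.
Qed.

Lemma functional_partial_separable (c : 'I_n -> V -> R) :
  (forall x, bounded_functional (c x)) ->
  functional_partial (fun nu v => \sum_x th x nu * c x v)
    (fun v => \sum_x dth x * c x v).
Proof.
move=> hc.
have /choice[C hC] : forall x, exists C, forall v, `|c x v| <= C * `|v|.
  by move=> x; have [C _ cC] := bf_bound (hc x); exists C.
exists (fun t => \sum_x `|t^-1 * (th x (shift t) - th x mu) - dth x| * C x).
  exact: separable_rate.
apply: nearW => t v; rewrite -sumrB mulr_sumr -sumrB mulr_suml.
rewrite (le_trans (ler_norm_sum _ _ _))//; apply: ler_sum => x _.
by rewrite -mulrBl mulrA -mulrBl normrM -mulrA ler_wpM2l.
Qed.

Lemma bilinear_partial_separable (c : 'I_n -> V -> V -> R) :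
  (forall x, bounded_bilinear (c x)) ->
  bilinear_partial (fun nu u v => \sum_x th x nu * c x u v)
    (fun u v => \sum_x dth x * c x u v).
Proof.
move=> hc.
have /choice[C hC] : forall x, exists C, forall u v, `|c x u v| <= C * `|u| * `|v|.
  by move=> x; have [C _ cC] := bb_bound (hc x); exists C.
exists (fun t => \sum_x `|t^-1 * (th x (shift t) - th x mu) - dth x| * C x).
  exact: separable_rate.
apply: nearW => t u v; rewrite -sumrB mulr_sumr -sumrB !mulr_suml.
rewrite (le_trans (ler_norm_sum _ _ _))//; apply: ler_sum => x _.
by rewrite -mulrBl mulrA -mulrBl normrM -!mulrA ler_wpM2l// mulrA.
Qed.

End Uniform.

Lemma partialE (f : 'rV[R]_P -> R) df : ~ G set0 -> has_partial (W := R^o) f df ->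
  partial D i f mu = df.
Proof.
move=> G0 hf; have PG : ProperFilter G by exact: Build_ProperFilter G0 _.
rewrite /partial; case: asboolP => // _.
apply: cvg_lim => //.
Qed.

(** The Fréchet expansion is restricted to the line through [mu] in direction [e_i]; its linear part
    there is [t * Df mu 0 i]. *)
Lemma has_partial_frechet f : D mu -> ~ G set0 -> twice_frechet_on D f ->
  has_partial (W := R^o) f (partial D i f mu).
Proof.
move=> Dmu G0 [Df [hDf _]]; have [L [LE hL]] := hDf mu Dmu.
suff hf : has_partial (W := R^o) f (Df mu 0 i) by rewrite (partialE G0 hf).
have cs : shift t @[t --> G] --> within D (nbhs mu).
  move=> A; rewrite /within /= => hA.
  have /(_ _ hA) : shift t @[t --> G] --> mu.
    rewrite -[X in _ --> X]addr0 -(scale0r (delta_mx 0 i)).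
    apply: cvgD; first exact: cvg_cst.
    by apply: cvgZr_tmp; exact: cvg_increments.
  by apply: filterS2 near_increments => t [Dt _] /(_ Dt).
(* The Fréchet quotient divides by [|t| * N] rather than by [|t|]; multiplying by [N] corrects this,
   and only [N != 0] has to be known. *)
pose N := `|delta_mx 0 i : 'rV[R]_P|.
have N0 : N != 0.
  rewrite normr_eq0; apply/eqP => /rowP/(_ i); rewrite !mxE !eqxx.
  by move/eqP; rewrite oner_eq0.
have h0 := cvg_comp _ _ cs hL.
apply: (cvg_dominated (g := fun t => `|f (shift t) - f mu - L (shift t - mu)|
   / `|shift t - mu| * N)).
  by rewrite -(mul0r N); apply: cvgM; [exact: h0|exact: cvg_cst].
apply: filterS near_increments => t [_ t0].
have -> : shift t - mu = t *: delta_mx 0 i by rewrite /shift addrC addKr.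
rewrite normrZ linearZ /= LE (bigD1 i)//= big1 => [|j /negPf ji]; last first.
  by rewrite mxE eqxx ji mulr0.
rewrite mxE !eqxx mulr1 addr0 -/N invfM mulrA divfK// -normfV -normrM mulrC.
by rewrite mulrBr /GRing.scale /= mulKf.
Qed.

(** * Differentiability of Galerkin solutions *)

Section Galerkin.
Context {V : normedModType R}.

Lemma functional_partialD f f' (df df' : V -> R) :
  functional_partial f df -> functional_partial f' df' ->
  functional_partial (fun nu v => f nu v + f' nu v) (fun v => df v + df' v).
Proof.
move=> [g g0 hg] [g' g0' hg']; exists (fun t => g t + g' t).
  by rewrite -[X in _ --> X]addr0; exact: cvgD.
apply: filterS2 hg hg' => t /= hg hg' v.
rewrite mulrDl; apply: le_trans (lerD (hg v) (hg' v)).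
apply: le_trans (ler_normD _ _); rewrite le_eqVlt; apply/orP; left.
by apply/eqP; congr `|_|; ring.
Qed.

Lemma functional_partialZ c f (df : V -> R) : functional_partial f df ->
  functional_partial (fun nu v => c * f nu v) (fun v => c * df v).
Proof.
move=> [g g0 hg]; exists (fun t => `|c| * g t).
  by rewrite -(mulr0 `|c|); apply: cvgM => //; exact: cvg_cst.
apply: filterS hg => t hg v; rewrite -mulrA -mulrBr mulrCA -mulrBr normrM.
exact: ler_wpM2l.
Qed.

(** This serves the dual right-hand side, in which the parameter enters [k_mu(v, u_mu)] both through
    the form and through the state. *)
Lemma functional_partial_bilinear b (db : V -> V -> R) u du :
  bounded_bilinear (b mu) -> bounded_bilinear db -> bilinear_partial b db ->
  has_partial u du ->
  functional_partial (fun nu v => b nu v (u nu))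
    (fun v => db v (u mu) + b mu v du).
Proof.
move=> hb hdb [h h0 hQ] hu.
have [C C0 bC] := bb_bound hb; have [K K0 dbK] := bb_bound hdb.
exists (fun t => h t * `|u (shift t)| + K * `|u (shift t) - u mu|
    + C * `|t^-1 *: (u (shift t) - u mu) - du|).
  have : h t * `|u (shift t)| + K * `|u (shift t) - u mu|
      + C * `|t^-1 *: (u (shift t) - u mu) - du| @[t --> G] -->
      0 * `|u mu| + K * 0 + C * 0.
    apply: cvgD; last by apply: cvgM; [exact: cvg_cst|exact: cvg_dist0].
    apply: cvgD; last first.
      by apply: cvgM; [exact: cvg_cst|apply: cvg_dist0; exact: has_partial_cvg hu].
    by apply: cvgM => //; apply: cvg_norm; exact: has_partial_cvg hu.
  by rewrite !(mul0r, mulr0, addr0).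
apply: filterS hQ => t hQ v.
(* The three terms are the remainder of the form at the moved state, the change of state inside
   [db], and the remainder of the state. *)
have -> : t^-1 * (b (shift t) v (u (shift t)) - b mu v (u mu))
    - (db v (u mu) + b mu v du) =
  (t^-1 * (b (shift t) v (u (shift t)) - b mu v (u (shift t))) - db v (u (shift t)))
  + db v (u (shift t) - u mu) + b mu v (t^-1 *: (u (shift t) - u mu) - du).
  rewrite (bbBr _ _ _ hdb) (bbBr _ _ _ hb) (bfZ _ _ (bb_functionalr v hb)).
  by rewrite (bbBr _ _ _ hb); ring.
rewrite (le_trans (ler_normD _ _))// !mulrDl lerD//.
  rewrite (le_trans (ler_normD _ _))// lerD//.
    by rewrite mulrAC.
  by rewrite mulrAC.
by rewrite mulrAC.
Qed.

(* Testing the difference of the equations at [mu + t e_i] and [mu] with the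
   error [e] of the difference quotient of [u] gives
   [alpha |e| <= o(1) + o(1) |e|], which yields boundedness and convergence of
   the difference quotients at once. *)
Lemma galerkin_has_partial (W : set V) (A : 'rV[R]_P -> V -> V -> R) dA b db u du :
  D mu -> is_subspace W -> bounded_bilinear (A mu) -> bounded_bilinear dA ->
  is_coercive (A mu) -> bilinear_partial A dA -> functional_partial b db ->
  (forall nu, D nu -> W (u nu) /\ forall v, W v -> A nu (u nu) v = b nu v) ->
  W du -> (forall v, W v -> A mu du v = db v - dA (u mu) v) ->
  has_partial u du.
Proof.
move=> Dmu [W0 Wlin] hA hdA [al al0 co] [h h0 hQ] [g g0 hb] hu Wdu hdu.
have [K K0 dAK] := bb_bound hdA.
have ct := cvg_increments.
(* The rates [g] and [h] carry no sign condition, hence the absolute values. *)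
have absG (k : R -> R) : k @ G --> 0 -> `|k t| @[t --> G] --> 0.
  by move=> k0; rewrite -(normr0 R); apply: cvg_norm.
have h0' := absG h h0; have g0' := absG g g0; have t0' := absG _ ct.
have small : \forall t \near G, (`|h t| + K) * `|t| <= al / 2.
  have : (`|h t| + K) * `|t| @[t --> G] --> (0 + K) * 0.
    by apply: cvgM => //; apply: cvgD => //; exact: cvg_cst.
  rewrite mulr0 => /cvgr0Pnorm_le/(_ (al / 2)).
  rewrite divr_gt0// => /(_ isT); apply: filterS => t.
  exact: le_trans (ler_norm _).
(* By [small], the part of the bound proportional to [|e|] is at most [al / 2 * |e|]; absorbing it
   on the left leaves [al / 2 * |e|], whence the factor [2 / al]. *)
apply: (cvg_dominated (g := fun t => 2 / al *
  (`|g t| + `|h t| * `|u mu| + (`|h t| + K) * (`|t| * `|du|)))).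
  have : 2 / al * (`|g t| + `|h t| * `|u mu| + (`|h t| + K) * (`|t| * `|du|))
      @[t --> G] --> 2 / al * (0 + 0 * `|u mu| + (0 + K) * (0 * `|du|)).
    apply: cvgM; first exact: cvg_cst.
    apply: cvgD.
      by apply: cvgD => //; apply: cvgM => //; exact: cvg_cst.
    apply: cvgM; first by apply: cvgD => //; exact: cvg_cst.
    by apply: cvgM => //; exact: cvg_cst.
  by rewrite !(mul0r, mulr0, addr0).
near=> t.
have [Dt t0] : D (shift t) /\ t != 0 by near: t; exact: near_increments.
have sm : (`|h t| + K) * `|t| <= al / 2 by near: t.
have Qt : forall u v,
    `|t^-1 * (A (shift t) u v - A mu u v) - dA u v| <= h t * `|u| * `|v|.
  by near: t.
have bt : forall v, `|t^-1 * (b (shift t) v - b mu v) - db v| <= g t * `|v|.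
  by near: t.
have [Wu Eu] := hu _ Dmu; have [Wut Eut] := hu _ Dt.
set s := t^-1 *: _; set e := s - du.
have We : W e.
  have Ws : W s.
    rewrite -[s]addr0; apply: (Wlin) => //.
    by rewrite addrC -scaleN1r; exact: Wlin.
  by rewrite /e addrC -scaleN1r; exact: Wlin.
have Ets : u (shift t) - u mu = t *: (e + du).
  by rewrite /e subrK /s scalerA divff// scale1r.
have dle : `|u (shift t) - u mu| <= `|t| * (`|e| + `|du|).
  by rewrite Ets normrZ ler_wpM2l// ler_normD.
have ule : `|u (shift t)| <= `|u mu| + `|t| * (`|e| + `|du|).
  rewrite -[u (shift t)](subrK (u mu)) addrC.
  by rewrite (le_trans (ler_normD _ _))// lerD2l.
(* The equations for [u (shift t)], [u mu] and [du] may all be tested with [e], since [e] lies in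
   [W]. *)
have key : A mu e e = (t^-1 * (b (shift t) e - b mu e) - db e)
    - (t^-1 * (A (shift t) (u (shift t)) e - A mu (u (shift t)) e) - dA (u (shift t)) e)
    - dA (u (shift t) - u mu) e.
  rewrite {1}/e (bbBl _ _ _ hA) hdu// /s (bbZl _ _ _ hA) (bbBl _ _ _ hA).
  by rewrite (bbBl _ _ _ hdA) Eu// Eut//; ring.
have est : al * `|e| ^+ 2 <= (`|g t| + `|h t| * (`|u mu| + `|t| * (`|e| + `|du|))
    + K * (`|t| * (`|e| + `|du|))) * `|e|.
  apply: (le_trans (co e)); rewrite key (le_trans (ler_norm _))//.
  rewrite (le_trans (ler_normB _ _))// !mulrDl lerD//.
    rewrite (le_trans (ler_normB _ _))// lerD//.
      by rewrite (le_trans (bt e))// ler_wpM2r// ler_norm.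
    rewrite (le_trans (Qt _ e))// ler_wpM2r//.
    by rewrite (le_trans (ler_wpM2r _ (ler_norm (h t))))// ler_wpM2l.
  by rewrite (le_trans (dAK _ _))// ler_wpM2r// ler_wpM2l.
have [->|e0] := eqVneq e 0.
  by rewrite normr0 mulr_ge0 ?divr_ge0 ?(ltW al0)// !addr_ge0// ?mulr_ge0 ?addr_ge0.
have ne : 0 < `|e| by rewrite normr_gt0.
move: est; rewrite expr2 [al * _]mulrA (ler_pM2r ne) => est.
have sm' := ler_wpM2r (normr_ge0 e) sm.
rewrite mulrAC ler_pdivlMr//; lra.
Unshelve. all: by end_near. Qed.

End Galerkin.
End DifferenceQuotients.

(** * The gradient of the corrected functional *)

Section Model.
Context {R : realType} {V : normedModType R} {P : nat}.
Variable pb : problem V P.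
Hypothesis hpb : standing_assumptions pb.
Implicit Types (mu : 'rV[R]_P) (i : 'I_P) (u v p q : V).

Let bca x : bounded_bilinear (c_a pb x).
Proof. exact: continuous_bounded_bilinear (@a_cont _ _ _ _ hpb x). Qed.
Let bck x : bounded_bilinear (c_k pb x).
Proof. exact: continuous_bounded_bilinear (@k_cont _ _ _ _ hpb x). Qed.
Let bcl x : bounded_functional (c_l pb x).
Proof. exact: continuous_bounded_functional (@l_cont _ _ _ _ hpb x). Qed.
Let bcj x : bounded_functional (c_j pb x).
Proof. exact: continuous_bounded_functional (@j_cont _ _ _ _ hpb x). Qed.

Lemma bounded_a mu : bounded_bilinear (a_mu pb mu).
Proof. exact: bounded_bilinear_sum. Qed.
Lemma bounded_k mu : bounded_bilinear (k_mu pb mu).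
Proof. exact: bounded_bilinear_sum. Qed.
Lemma bounded_l mu : bounded_functional (l_mu pb mu).
Proof. exact: bounded_functional_sum. Qed.
Lemma bounded_j mu : bounded_functional (j_mu pb mu).
Proof. exact: bounded_functional_sum. Qed.
Lemma bounded_d_a i mu : bounded_bilinear (d_a pb i mu).
Proof. exact: bounded_bilinear_sum. Qed.
Lemma bounded_d_k i mu : bounded_bilinear (d_k pb i mu).
Proof. exact: bounded_bilinear_sum. Qed.
Lemma bounded_d_l i mu : bounded_functional (d_l pb i mu).
Proof. exact: bounded_functional_sum. Qed.
Lemma bounded_d_j i mu : bounded_functional (d_j pb i mu).
Proof. exact: bounded_functional_sum. Qed.

Lemma bounded_r_pr mu u : bounded_functional (r_pr pb mu u).
Proof.
apply: bounded_functionalB (bounded_l mu) _.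
exact: bb_functionalr (bounded_a mu).
Qed.

Lemma bounded_r_du mu u p : bounded_functional (r_du pb mu u p).
Proof.
apply: bounded_functionalB; last exact: bb_functionall (bounded_a mu).
apply: bounded_functionalD (bounded_j mu) _.
by apply: bounded_functionalZ; exact: bb_functionall (bounded_k mu).
Qed.

Lemma bounded_d_r_pr i mu u : bounded_functional (d_r_pr pb i mu u).
Proof.
apply: bounded_functionalB (bounded_d_l i mu) _.
exact: bb_functionalr (bounded_d_a i mu).
Qed.

Lemma bounded_d_r_du i mu u p : bounded_functional (d_r_du pb i mu u p).
Proof.
apply: bounded_functionalB; last exact: bb_functionall (bounded_d_a i mu).
apply: bounded_functionalD (bounded_d_j i mu) _.
by apply: bounded_functionalZ; exact: bb_functionall (bounded_d_k i mu).
Qed.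

Lemma bounded_sens_r_pr i mu u u' : bounded_functional (sens_r_pr pb i mu u u').
Proof.
apply: bounded_functionalB (bounded_d_r_pr i mu u) _.
exact: bb_functionalr (bounded_a mu).
Qed.

Lemma bounded_sens_r_du i mu u p u' p' :
  bounded_functional (sens_r_du pb i mu u p u' p').
Proof.
apply: bounded_functionalB; last exact: bb_functionall (bounded_a mu).
apply: bounded_functionalD (bounded_d_r_du i mu u p) _.
by apply: bounded_functionalZ; exact: bb_functionall (bounded_k mu).
Qed.

(** * Directions in which the box is flat *)

Section Flat.
Variables (i : 'I_P) (mu : 'rV[R]_P).
Hypothesis flat : increments (box pb) i mu set0.

Lemma partial_flat f : partial (box pb) i f mu = 0.
Proof. by rewrite /partial; case: asboolP. Qed.

Lemma d_a_flat u v : d_a pb i mu u v = 0.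
Proof. by apply: big1 => x _; rewrite partial_flat mul0r. Qed.
Lemma d_k_flat u v : d_k pb i mu u v = 0.
Proof. by apply: big1 => x _; rewrite partial_flat mul0r. Qed.
Lemma d_l_flat v : d_l pb i mu v = 0.
Proof. by apply: big1 => x _; rewrite partial_flat mul0r. Qed.
Lemma d_j_flat v : d_j pb i mu v = 0.
Proof. by apply: big1 => x _; rewrite partial_flat mul0r. Qed.

End Flat.

(** * Derivatives of the functional and of the primal and dual solutions *)

Section Partials.
Variables (i : 'I_P) (mu : 'rV[R]_P).
Hypotheses (hmu : box pb mu) (nonflat : ~ increments (box pb) i mu set0).

Let has_partial_coef f : twice_frechet_on (box pb) f ->
  has_partial (box pb) i mu (W := R^o) f (partial (box pb) i f mu).
Proof. exact: has_partial_frechet. Qed.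

Let part_a x := has_partial_coef (@a_diff _ _ _ _ hpb x).
Let part_l x := has_partial_coef (@l_diff _ _ _ _ hpb x).
Let part_j x := has_partial_coef (@j_diff _ _ _ _ hpb x).
Let part_k x := has_partial_coef (@k_diff _ _ _ _ hpb x).

(** Applied to a constant [u], this also gives the derivative at fixed state in [d_costE]. *)
Lemma has_partial_cost (u : 'rV[R]_P -> V) du : has_partial (box pb) i mu u du ->
  has_partial (box pb) i mu (W := R^o) (fun nu => cost pb (u nu) nu)
    (partial (box pb) i (Theta pb) mu
     + (d_j pb i mu (u mu) + j_mu pb mu du)
     + (d_k pb i mu (u mu) (u mu)
        + (k_mu pb mu du (u mu) + k_mu pb mu (u mu) du))).
Proof.
move=> hu; apply: (has_partialD (W := R^o)).
  apply: (has_partialD (W := R^o)); first exact: has_partial_coef (Theta_diff hpb).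
  exact: (has_partial_separable_functional part_j bcj hu).
exact: (has_partial_separable_bilinear part_k bck hu hu).
Qed.

(** The plain total derivative, before any Galerkin equation is used; [gradient_J_r] regroups its
    terms into residuals. *)
Lemma has_partial_J_r (u p : 'rV[R]_P -> V) du dp :
  has_partial (box pb) i mu u du -> has_partial (box pb) i mu p dp ->
  has_partial (box pb) i mu (W := R^o) (J_r pb u p)
    (partial (box pb) i (Theta pb) mu
     + (d_j pb i mu (u mu) + j_mu pb mu du)
     + (d_k pb i mu (u mu) (u mu)
        + (k_mu pb mu du (u mu) + k_mu pb mu (u mu) du))
     + ((d_l pb i mu (p mu) + l_mu pb mu dp)
        - (d_a pb i mu (u mu) (p mu)
           + (a_mu pb mu du (p mu) + a_mu pb mu (u mu) dp)))).
Proof.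
move=> hu hp; apply: (has_partialD (W := R^o)); first exact: has_partial_cost.
apply: (has_partialB (W := R^o)).
  exact: (has_partial_separable_functional part_l bcl hp).
exact: (has_partial_separable_bilinear part_a bca hu hp).
Qed.

Lemma has_partial_primal (W : set V) (u : 'rV[R]_P -> V) u' : is_subspace W ->
  (forall nu, box pb nu -> solves_pr pb W nu (u nu)) ->
  solves_sens_pr pb W i mu (u mu) u' -> has_partial (box pb) i mu u u'.
Proof.
move=> hW hu [Wu' hu'].
apply: (galerkin_has_partial hmu hW (bounded_a mu) (bounded_d_a i mu)
  (a_coer hpb hmu) _ _ hu Wu' hu').
- exact: (bilinear_partial_separable part_a bca).
- exact: (functional_partial_separable part_l bcl).
Qed.

(** The primal derivative comes first because the dual right-hand side depends on [u]; it
    contributes the term [2 k(v, u')]. *)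
Lemma has_partial_dual (W : set V) (u p : 'rV[R]_P -> V) u' p' : is_subspace W ->
  has_partial (box pb) i mu u u' ->
  (forall nu, box pb nu -> solves_du pb W nu (u nu) (p nu)) ->
  solves_sens_du pb W i mu (u mu) (p mu) u' p' -> has_partial (box pb) i mu p p'.
Proof.
move=> hW hu hp [Wp' hp'].
apply: (@galerkin_has_partial _ _ _ _ _ _ W (fun nu => flip (a_mu pb nu))
  (flip (d_a pb i mu)) (fun nu v => j_mu pb nu v + 2 * k_mu pb nu v (u nu))
  (fun v => d_j pb i mu v + 2 * (d_k pb i mu v (u mu) + k_mu pb mu v u'))) => //.
- exact: flip_bounded_bilinear (bounded_a mu).
- exact: flip_bounded_bilinear (bounded_d_a i mu).
- exact: (a_coer hpb hmu).
- have [g g0 hg] := bilinear_partial_separable part_a bca.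
  by exists g => //; apply: filterS hg => t hg v w; rewrite mulrAC; exact: hg.
- apply: functional_partialD; first exact: (functional_partial_separable part_j bcj).
  apply: functional_partialZ; apply: functional_partial_bilinear => //.
  + exact: bounded_k.
  + exact: bounded_d_k.
  + exact: (bilinear_partial_separable part_k bck).
- by move=> v Wv; rewrite /flip hp'// /d_r_du; ring.
Qed.

End Partials.

Lemma d_costE i u mu : box pb mu -> d_cost pb i u mu =
  partial (box pb) i (Theta pb) mu + d_j pb i mu u + d_k pb i mu u u.
Proof.
move=> hmu; have [flat|nonflat] := pselect (increments (box pb) i mu set0).
  by rewrite /d_cost !partial_flat// d_j_flat// d_k_flat// !addr0.
have := has_partial_cost hmu nonflat (has_partial_cst _ _ _ u).
move=> /(partialE nonflat); rewrite /d_cost => ->.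
by rewrite (bf0 (bounded_j mu)) (bb0l _ (bounded_k mu)) (bb0r _ (bounded_k mu)) !addr0.
Qed.

(** Symmetry is assumed for the sum [k_mu] on the box, not for its components. It is inherited
    because [d_k] is the derivative, relative to the box, of [k_mu] at fixed arguments. *)
Lemma d_k_sym i mu : box pb mu -> is_symmetric (d_k pb i mu).
Proof.
move=> hmu u v; have [flat|nonflat] := pselect (increments (box pb) i mu set0).
  by rewrite !d_k_flat.
have dkE w z : partial (box pb) i (fun nu => k_mu pb nu w z) mu = d_k pb i mu w z.
  have := has_partial_separable_bilinear
    (fun x => has_partial_frechet hmu nonflat (@k_diff _ _ _ _ hpb x)) bck
    (has_partial_cst _ _ _ w) (has_partial_cst _ _ _ z).
  move=> /(partialE nonflat) ->.
  by rewrite [X in _ + (X + _)](bb0l _ (bounded_k mu))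
    [X in _ + (_ + X)](bb0r _ (bounded_k mu)) !addr0.
rewrite -!dkE; apply: (partialE nonflat).
have := has_partial_separable_bilinear
  (fun x => has_partial_frechet hmu nonflat (@k_diff _ _ _ _ hpb x)) bck
  (has_partial_cst _ _ _ v) (has_partial_cst _ _ _ u).
move=> /[dup] /(partialE nonflat) <-; apply: eq_has_partial => // nu.
by rewrite inE => hnu; exact: k_sym.
Qed.

Lemma gradient_J_r (Wpr Wdu : set V) (u p : 'rV[R]_P -> V) mu (u' p' : 'I_P -> V) :
  is_subspace Wpr -> is_subspace Wdu ->
  (forall nu, box pb nu -> solves_pr pb Wpr nu (u nu)) ->
  (forall nu, box pb nu -> solves_du pb Wdu nu (u nu) (p nu)) ->
  box pb mu ->
  (forall i, solves_sens_pr pb Wpr i mu (u mu) (u' i)) ->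
  (forall i, solves_sens_du pb Wdu i mu (u mu) (p mu) (u' i) (p' i)) ->
  gradient (box pb) (J_r pb u p) mu = sens_gradient pb mu (u mu) (p mu) u' p'.
Proof.
move=> hWpr hWdu hu hp hmu hu' hp'; apply/rowP => i; rewrite !mxE.
rewrite d_costE//.
have [flat|nonflat] := pselect (increments (box pb) i mu set0).
  have coercive0 w : a_mu pb mu w w = 0 -> w = 0.
    have [al al0 co] := a_coer hpb hmu => w0; apply/eqP.
    rewrite -normr_eq0 -sqrf_eq0 eq_le sqr_ge0 andbT.
    by rewrite -(ler_pM2l al0) mulr0 -w0.
  have u'0 : u' i = 0.
    have [Wu' eu'] := hu' i; apply: coercive0; rewrite eu'// /d_r_pr.
    by rewrite d_l_flat// d_a_flat// subr0.
  have p'0 : p' i = 0.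
    have [Wp' ep'] := hp' i; apply: coercive0; rewrite ep'// /d_r_du u'0.
    rewrite d_j_flat// d_a_flat// d_k_flat// (bb0r _ (bounded_k mu)).
    by rewrite mulr0 subr0 !addr0.
  rewrite u'0 p'0 (bf0 (bounded_r_pr _ _)) (bf0 (bounded_r_du _ _ _)) /d_r_pr.
  by rewrite !partial_flat// d_j_flat// d_k_flat// d_l_flat// d_a_flat// subr0 !addr0.
have pu := has_partial_primal hmu nonflat hWpr hu (hu' i).
have pp := has_partial_dual hmu nonflat hWdu pu hp (hp' i).
rewrite (partialE nonflat (has_partial_J_r hmu nonflat pu pp)).
(* Symmetry merges the two [k] terms into [2 k(u', u)]; the terms in [p'] then form [r_pr(u)(p')]
   and those in [u'] form [r_du(u, p)(u')]. *)
rewrite (k_sym hpb hmu (u mu)) /r_pr /r_du /d_r_pr; ring.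
Qed.

End Model.

(** * Error estimate *)

Lemma finite_dim_subspace (R : realType) (V : normedModType R) (W : set V) :
  is_finite_dim W -> is_subspace W.
Proof.
move=> [n [phi ->]]; split.
  by exists (fun=> 0) => //; rewrite big1// => k _; rewrite scale0r.
move=> c _ _ [x _ <-] [y _ <-]; exists (fun k => c * x k + y k) => //.
rewrite scaler_sumr -big_split; apply: eq_bigr => k _ /=.
by rewrite scalerDl scalerA.
Qed.

Lemma subspaceB (R : realType) (V : normedModType R) (W : set V) (u v : V) :
  is_subspace W -> W u -> W v -> W (u - v).
Proof. by move=> [_ Wlin] Wu Wv; rewrite addrC -scaleN1r; exact: Wlin. Qed.

Lemma le_norm2 (R : realType) (P : nat) (x y : 'rV[R]_P) :
  (forall i, `|x 0 i| <= y 0 i) -> norm2 x <= norm2 y.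
Proof.
move=> xy; rewrite /norm2 ler_wsqrtr// ler_sum// => i _.
by rewrite -real_normK ?num_real// lerXn2r ?nnegrE// (le_trans _ (xy i)).
Qed.

Section ErrorEstimate.
Context {R : realType} {V : normedModType R} {P : nat}.
Variable pb : problem V P.
Hypothesis hpb : standing_assumptions pb.
Variables (Vh : set V) (mu : 'rV[R]_P).
Hypotheses (hVh : is_subspace Vh) (hmu : box pb mu).
Variables (u p u_h p_h : V).
Hypotheses (Vu : Vh u) (Vp : Vh p).
Hypotheses (hu_h : solves_pr pb Vh mu u_h) (hp_h : solves_du pb Vh mu u_h p_h).

Let a_bb := bounded_a hpb mu.
Let k_bb := bounded_k hpb mu.

(** The full order equation tested with [e = u_h - u] gives [a(e, e) = r_pr(u)(e)], for any [u] in
    [Vh]. *)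
Lemma primal_error : `|u_h - u| <= Delta_pr pb Vh mu u.
Proof.
have [Vu_h eu_h] := hu_h.
have Ve : Vh (u_h - u) by exact: subspaceB.
apply: (le_coer_const (a_coer hpb hmu) Ve (dual_norm_ge0 _ _) _).
apply: (le_trans _ (le_dual_norm (bounded_r_pr hpb mu u) Ve)).
by rewrite bbBl// eu_h// ler_norm.
Qed.

Lemma Delta_pr_ge0 : 0 <= Delta_pr pb Vh mu u.
Proof. exact: le_trans primal_error. Qed.

Lemma dual_error : `|p_h - p| <= Delta_du pb Vh mu u p.
Proof.
have [Vp_h ep_h] := hp_h; have [Vu_h _] := hu_h.
have Ve : Vh (u_h - u) by exact: subspaceB.
have Veps : Vh (p_h - p) by exact: subspaceB.
apply: (le_coer_const (a_coer hpb hmu) Veps _ _).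
  rewrite addr_ge0 ?dual_norm_ge0// mulr_ge0 ?Delta_pr_ge0//.
  by rewrite mulr_ge0 ?cont_const_ge0.
(* The [k] term appears because the full order adjoint equation is posed at [u_h], while [r_du] is
   evaluated at [u]. *)
have -> : a_mu pb mu (p_h - p) (p_h - p) =
    2 * k_mu pb mu (p_h - p) (u_h - u) + r_du pb mu u p (p_h - p).
  by rewrite (bbBr _ _ _ a_bb) ep_h// (bbBr _ _ _ k_bb) /r_du; ring.
rewrite [X in _ <= X]mulrDl (le_trans (ler_norm _))//.
rewrite (le_trans (ler_normD _ _))// lerD//.
  rewrite normrM ger0_norm// -!mulrA ler_wpM2l//.
  rewrite (le_trans (le_cont_const k_bb Veps Ve))// -mulrA.
  rewrite ler_wpM2l ?cont_const_ge0// mulrC mulrA ler_wpM2r//.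
  exact: primal_error.
exact: le_dual_norm (bounded_r_du hpb mu u p) Veps.
Qed.

Section Sensitivity.
Variables (i : 'I_P) (u_h' u' p' : V).
Hypotheses (hu_h' : solves_sens_pr pb Vh i mu u_h u_h') (Vu' : Vh u') (Vp' : Vh p').

Lemma sensitivity_error : `|u_h' - u'| <= Delta_sens_pr pb Vh i mu u u'.
Proof.
have [Vu_h' eu_h'] := hu_h'; have [Vu_h _] := hu_h.
have Ve : Vh (u_h - u) by exact: subspaceB.
have Ve' : Vh (u_h' - u') by exact: subspaceB.
have da_bb := bounded_d_a hpb i mu.
apply: (le_coer_const (a_coer hpb hmu) Ve' _ _).
  rewrite addr_ge0 ?dual_norm_ge0// mulr_ge0 ?Delta_pr_ge0//.
  exact: cont_const_ge0.
(* The sensitivity equation of [u_h'] is posed at [u_h], the residual at [u]; linearity of [d_a]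
   leaves [d_a(u_h - u, .)]. *)
have -> : a_mu pb mu (u_h' - u') (u_h' - u') =
    - d_a pb i mu (u_h - u) (u_h' - u') + sens_r_pr pb i mu u u' (u_h' - u').
  rewrite (bbBl _ _ _ a_bb) eu_h'// (bbBl _ _ _ da_bb) /sens_r_pr /d_r_pr; ring.
rewrite [X in _ <= X]mulrDl (le_trans (ler_norm _))//.
rewrite (le_trans (ler_normD _ _))// lerD//.
  rewrite normrN (le_trans (le_cont_const da_bb Ve Ve'))//.
  by rewrite ler_wpM2r// ler_wpM2l ?cont_const_ge0// primal_error.
exact: le_dual_norm (bounded_sens_r_pr hpb i mu u u') Ve'.
Qed.

(** The full order side has two terms only, since both residuals at [u_h], [p_h] vanish on [Vh]. The
    three summands of the estimator bound the three terms of an exact error identity. *)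
Lemma gradient_error :
  `|(d_cost pb i u_h mu + d_r_pr pb i mu u_h p_h)
    - (d_cost pb i u mu + d_r_pr pb i mu u p + r_pr pb mu u p' + r_du pb mu u p u')|
  <= cont_const Vh (d_k pb i mu) * Delta_pr pb Vh mu u ^+ 2
     + cont_const Vh (a_mu pb mu) * Delta_sens_pr pb Vh i mu u u'
       * Delta_du pb Vh mu u p
     + dual_norm Vh (sens_r_du pb i mu u p u' p') * Delta_pr pb Vh mu u.
Proof.
have [Vu_h eu_h] := hu_h; have [Vp_h ep_h] := hp_h; have [Vu_h' eu_h'] := hu_h'.
have Ve : Vh (u_h - u) by exact: subspaceB.
have Veps : Vh (p_h - p) by exact: subspaceB.
have Ve' : Vh (u_h' - u') by exact: subspaceB.
have da_bb := bounded_d_a hpb i mu; have dk_bb := bounded_d_k hpb i mu.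
have -> : (d_cost pb i u_h mu + d_r_pr pb i mu u_h p_h)
    - (d_cost pb i u mu + d_r_pr pb i mu u p + r_pr pb mu u p' + r_du pb mu u p u')
  = d_k pb i mu (u_h - u) (u_h - u) + a_mu pb mu (u_h' - u') (p_h - p)
    + sens_r_du pb i mu u p u' p' (u_h - u).
  rewrite (bfB _ _ (bounded_sens_r_du hpb i mu u p u' p')) !d_costE//.
  rewrite (bbBl _ _ _ a_bb) eu_h'// (bbBr _ _ _ a_bb).
  rewrite (bbBl _ _ _ dk_bb) !(bbBr _ _ _ dk_bb).
  rewrite /sens_r_du /d_r_du /r_pr /r_du /d_r_pr.
  rewrite (bfB _ _ (bounded_d_l hpb i mu)) (bbBr _ _ _ da_bb).
  (* The full order primal equation is tested with [p'] and the adjoint equation with [u'], which is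
     where membership of [p'] and [u'] in [Vh] enters. *)
  rewrite -(eu_h _ Vp') (ep_h _ Vu') (d_k_sym hpb i hmu u u_h).
  by rewrite (k_sym hpb hmu u_h) (k_sym hpb hmu u u'); ring.
have D0 := Delta_pr_ge0; have g0 := @cont_const_ge0 _ _ Vh.
rewrite (le_trans (ler_normD _ _))// lerD//.
  rewrite (le_trans (ler_normD _ _))// lerD//.
    rewrite (le_trans (le_cont_const dk_bb Ve Ve))// expr2 -mulrA ler_wpM2l//.
    by rewrite ler_pM// primal_error.
  rewrite (le_trans (le_cont_const a_bb Ve' Veps))//.
  rewrite -[X in X <= _]mulrA -[X in _ <= X]mulrA ler_wpM2l//.
  by apply: ler_pM => //; [exact: sensitivity_error|exact: dual_error].
rewrite (le_trans (le_dual_norm (bounded_sens_r_du hpb i mu u p u' p') Ve))//.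
by rewrite ler_wpM2l ?dual_norm_ge0// primal_error.
Qed.

End Sensitivity.
End ErrorEstimate.

Theorem proposition2p13 (R : realType) (V : completeNormedModType R)
  (ip : {bilinear V -> V -> R^o}) (hV : is_inner_product ip)
  (P : nat) (pb : problem V P) (hpb : standing_assumptions pb)
  (V_h : set V) (hVh : is_finite_dim V_h)
  (V_pr V_du : set V)
  (hVpr : is_subspace V_pr /\ V_pr `<=` V_h)
  (hVdu : is_subspace V_du /\ V_du `<=` V_h)
  (V_dpr V_ddu : 'I_P -> set V)
  (hVdpr : forall i, is_subspace (V_dpr i) /\ V_dpr i `<=` V_h)
  (hVddu : forall i, is_subspace (V_ddu i) /\ V_ddu i `<=` V_h)
  (u_h u_r p_r : 'rV[R]_P -> V)
  (hu_h : forall nu, box pb nu -> solves_pr pb V_h nu (u_h nu))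
  (hu_r : forall nu, box pb nu -> solves_pr pb V_pr nu (u_r nu))
  (hp_r : forall nu, box pb nu -> solves_du pb V_du nu (u_r nu) (p_r nu))
  (mu : 'rV[R]_P) (hmu : box pb mu)
  (du_r dp_r : 'I_P -> V)
  (hdu_r : forall i, solves_sens_pr pb V_pr i mu (u_r mu) (du_r i))
  (hdp_r : forall i,
     solves_sens_du pb V_du i mu (u_r mu) (p_r mu) (du_r i) (dp_r i))
  (tdu_r tdp_r : 'I_P -> V)
  (htdu_r : forall i, solves_sens_pr pb (V_dpr i) i mu (u_r mu) (tdu_r i))
  (htdp_r : forall i,
     solves_sens_du pb (V_ddu i) i mu (u_r mu) (p_r mu) (tdu_r i) (tdp_r i)) :
  (gradient (box pb) (J_r pb u_r p_r) mu
     = sens_gradient pb mu (u_r mu) (p_r mu) du_r dp_r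
   /\ norm2 (gradient (box pb) (J_h pb u_h) mu
             - gradient (box pb) (J_r pb u_r p_r) mu)
      <= norm2 (Delta_gradient pb V_h mu (u_r mu) (p_r mu) du_r dp_r))
  /\
  norm2 (gradient (box pb) (J_h pb u_h) mu
         - sens_gradient pb mu (u_r mu) (p_r mu) tdu_r tdp_r)
  <= norm2 (Delta_gradient pb V_h mu (u_r mu) (p_r mu) tdu_r tdp_r).

Proof.
have subVh := finite_dim_subspace hVh.
have [[sVpr Vpr_h] [sVdu Vdu_h]] := (hVpr, hVdu).
(* The value 0 outside the box makes the correction vanish there too, so that [J_h] and [J_r] agree
   as functions on the whole space. *)
have /choice[p_h hp_h] : forall nu, exists p, (box pb nu ->
    solves_du pb V_h nu (u_h nu) p) /\ (~ box pb nu -> p = 0).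
  move=> nu; have [hnu|hnu] := pselect (box pb nu); last by exists 0.
  have [p Vp ep] := lax_milgram_finite_dim hVh
    (flip_bounded_bilinear (bounded_a hpb nu)) (a_coer hpb hnu)
    (bounded_functionalD (bounded_j hpb nu)
      (bounded_functionalZ 2 (bb_functionall (u_h nu) (bounded_k hpb nu)))).
  by exists p; split.
have hp_h1 nu (hnu : box pb nu) := (hp_h nu).1 hnu.
have /choice[u_h' hu_h'] : forall i, exists u', solves_sens_pr pb V_h i mu (u_h mu) u'.
  move=> i; have [u' Vu' eu'] := lax_milgram_finite_dim hVh
    (bounded_a hpb mu) (a_coer hpb hmu) (bounded_d_r_pr hpb i mu (u_h mu)).
  by exists u'.
have /choice[p_h' hp_h'] : forall i, exists p',
    solves_sens_du pb V_h i mu (u_h mu) (p_h mu) (u_h' i) p'.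
  move=> i; have [p' Vp' ep'] := lax_milgram_finite_dim hVh
    (flip_bounded_bilinear (bounded_a hpb mu)) (a_coer hpb hmu)
    (bounded_functionalD (bounded_d_r_du hpb i mu (u_h mu) (p_h mu))
      (bounded_functionalZ 2 (bb_functionall (u_h' i) (bounded_k hpb mu)))).
  by exists p'; split.
have J_hE : J_h pb u_h = J_r pb u_h p_h.
  apply/funext => nu; rewrite /J_r; have [hnu|hnu] := pselect (box pb nu).
    have [Vp _] := hp_h1 _ hnu; have [_ eu] := hu_h _ hnu.
    by rewrite /r_pr eu// subrr addr0.
  by rewrite (hp_h nu).2// (bf0 (bounded_r_pr hpb nu _)) addr0.
have [Vp eph] := hp_h1 _ hmu; have [Vu euh] := hu_h _ hmu.
(* Full order sensitivities lie in [V_h], where both full order residuals vanish, so they drop out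
   of the gradient. *)
have gradE i : gradient (box pb) (J_h pb u_h) mu 0 i =
    d_cost pb i (u_h mu) mu + d_r_pr pb i mu (u_h mu) (p_h mu).
  rewrite J_hE (gradient_J_r hpb subVh subVh hu_h hp_h1 hmu hu_h' hp_h') mxE.
  have [[Vu' _] [Vp' _]] := (hu_h' i, hp_h' i).
  by rewrite /r_pr /r_du euh// eph// !subrr !addr0.
(* Stated for arbitrary elements of [V_h], this covers the exact and the approximate reduced
   sensitivities alike. *)
have bound u' p' : (forall i, V_h (u' i)) -> (forall i, V_h (p' i)) ->
  norm2 (gradient (box pb) (J_h pb u_h) mu
         - sens_gradient pb mu (u_r mu) (p_r mu) u' p')
  <= norm2 (Delta_gradient pb V_h mu (u_r mu) (p_r mu) u' p').
  move=> Vu' Vp'; apply: le_norm2 => i; rewrite mxE gradE !mxE.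
  apply: (gradient_error hpb subVh hmu (Vpr_h _ (hu_r _ hmu).1)
    (Vdu_h _ (hp_r _ hmu).1) (hu_h _ hmu) (hp_h1 _ hmu) (hu_h' i)) => //.
have gradJ_r := gradient_J_r hpb sVpr sVdu hu_r hp_r hmu hdu_r hdp_r.
split; [split=> //; rewrite gradJ_r|]; apply: bound => i.
- exact: Vpr_h (hdu_r i).1.
- exact: Vdu_h (hdp_r i).1.
- exact: (hVdpr i).2 (htdu_r i).1.
- exact: (hVddu i).2 (htdp_r i).1.
Qed.
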